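(* Let $A=\begin{pmatrix}a&b\\c&d\end{pmatrix}$ be a $2\times 2$ matrix with complex entries, let $n\geq 1$ be an integer, and denote the entries of $A^n$ by $A^{n}=\begin{pmatrix}a_n&b_n\\c_n&d_n\end{pmatrix}$. Then \begin{align*} a_{n}&=a^{n}+\sum_{s=1}^{\lfloor\frac{n}{2}\rfloor}\sum_{m=0}^{n-2s}\binom{n-s-m}{s}\binom{m+s-1}{m}a^{n-2s-m}b^{s}c^{s}d^{m},\\ b_{n}&=\sum_{s=0}^{\lfloor\frac{n-1}{2}\rfloor}\sum_{m=0}^{n-2s-1}\binom{n-s-m-1}{s}\binom{m+s}{m} a^{n-2s-m-1}b^{s+1}c^{s}d^{m},\\ c_{n}&=\sum_{s=0}^{\lfloor\frac{n-1}{2}\rfloor}\sum_{m=0}^{n-2s-1}\binom{n-s-m-1}{s}\binom{m+s}{m} a^{n-2s-m-1}b^{s}c^{s+1}d^{m},\\ d_{n}&=d^{n}+\sum_{s=1}^{\lfloor\frac{n}{2}\rfloor}\sum_{m=0}^{n-2s}\binom{n-s-m-1}{s-1}\binom{m+s}{m} a^{n-2s-m}b^{s}c^{s}d^{m}. \end{align*}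
   Context: $\lfloor x\rfloor$ is the floor function. Empty sums are $0$, and $x^0=1$ for every $x$, including $x=0$. *)

(* Defs.v *)
From mathcomp Require Export all_boot all_order all_algebra.
From mathcomp Require Export reals complex.

Set Implicit Arguments.
Unset Strict Implicit.
Unset Printing Implicit Defensive.

(* Main.v *)
Require Import Defs.
From mathcomp Require Import zify ring.
Import GRing.Theory.
Local Open Scope ring_scope.

(** The entries of A^n are the weighted counts of n-step walks on two states,
    where staying at the first state weighs [a], staying at the second weighs
    [d], and the two crossings weigh [b] and [c].  A walk from the first state
    to itself with [2 s] crossings pauses during [s + 1] visits to the first
    state and [s] visits to the second, so that the walks of this kind have the
    generating function
      (bc)^s t^(2s) / ((1 - a t)^(s+1) (1 - d t)^s),
    and similarly a walk from the first state to the second with [2 s + 1]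
    crossings contributes
      b (bc)^s t^(2s+1) / ((1 - a t)^(s+1) (1 - d t)^(s+1)).
    Expanding the negative powers by the binomial series gives the formulas.

    The proof avoids power series: [stayc a d p q N] is the coefficient of t^N
    in 1 / ((1 - a t)^p (1 - d t)^q), and [walkc] is its shift by the number of
    crossings.  Multiplying by a factor [1 - a t] or [1 - d t] becomes the
    recurrences [walkcSl] and [walkcSr], which are exactly what the recurrence
    A^(n+1) = A^n A needs ([row_closed_form]).  Each row of A^n obeys the same
    recurrence, with the roles of the two states exchanged, so one induction
    covers all four entries. *)

Section StayCoefficients.
Variable R : comNzRingType.
Implicit Types (a d : R) (p q k j N : nat).

(** The binomial series coefficient of x^j in (1 - x)^(-p).  The truncated
    predecessor gives the right value also for [p = 0], namely 1 at [j = 0] and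
    0 elsewhere. *)
Definition negbin p j := 'C((j + p).-1, j).

Lemma negbin0 p : negbin p 0 = 1%N.
Proof. exact: bin0. Qed.

Lemma negbin0S j : negbin 0 j.+1 = 0%N.
Proof. by rewrite /negbin addn0 bin_small. Qed.

Lemma negbinSS p j : negbin p.+1 j.+1 = (negbin p.+1 j + negbin p j.+1)%N.
Proof. by rewrite /negbin !addnS !addSn /= binS addnC. Qed.

Lemma negbin1 j : negbin 1 j = 1%N.
Proof. by rewrite /negbin addn1 binn. Qed.

Lemma negbinS p j : negbin p.+1 j = 'C(j + p, p).
Proof. by rewrite /negbin addnS /= -bin_sub ?leq_addr// addKn. Qed.

(** The coefficient of t^N in 1 / ((1 - a t)^p (1 - d t)^q), as the Cauchy
    product of two binomial series. *)
Definition stayc a d p q N : R :=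
  \sum_(m < N.+1) (negbin p (N - m))%:R * (negbin q m)%:R * a ^+ (N - m) * d ^+ m.

Lemma stayc0 a d p q : stayc a d p q 0 = 1.
Proof. by rewrite /stayc big_ord1 subnn !negbin0 !expr0 !mulr1. Qed.

Lemma staycC a d p q N : stayc a d p q N = stayc d a q p N.
Proof.
rewrite /stayc (reindex_inj rev_ord_inj) /=; apply: eq_bigr => m _.
rewrite subSS subKn -1?ltnS //; ring.
Qed.

(** Multiply the series by [1 - a t]. *)
Lemma staycSl a d p q N :
  stayc a d p.+1 q N.+1 = a * stayc a d p.+1 q N + stayc a d p q N.+1.
Proof.
rewrite /stayc big_ord_recr [X in _ = _ + X]big_ord_recr /= subnn !negbin0 addrA.
congr (_ + _); rewrite big_distrr -big_split; apply: eq_bigr => m _ /=.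
rewrite subSn -1?ltnS // negbinSS natrD exprS; ring.
Qed.

Lemma stayc10 a d N : stayc a d 1 0 N = a ^+ N.
Proof.
rewrite /stayc big_ord_recl subn0 negbin1 negbin0 big1 => [|m _].
  by rewrite /= expr0 !mul1r mulr1 addr0.
by rewrite negbin0S mulr0 !mul0r.
Qed.

(** A walk of length [N] with [k] crossings stays put [N - k] times; there is
    none if [N < k], where the truncated [N - k] would give a wrong value. *)
Definition walkc a d p q k N : R := if (k <= N)%N then stayc a d p q (N - k) else 0.

Lemma walkcSS a d p q k N : walkc a d p q k.+1 N.+1 = walkc a d p q k N.
Proof. by []. Qed.

Lemma walkcSl a d p q k N :
  walkc a d p.+1 q k N.+1 = a * walkc a d p.+1 q k N + walkc a d p q k N.+1.
Proof.
rewrite /walkc; case: (ltngtP k N.+1) => [lekN | ltNk | ->].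
- by rewrite -ltnS lekN subSn // staycSl.
- by rewrite leqNgt (ltnW ltNk) mulr0 addr0.
- by rewrite ltnn subnn !stayc0 mulr0 add0r.
Qed.

Lemma walkcC a d p q k N : walkc a d p q k N = walkc d a q p k N.
Proof. by rewrite /walkc staycC. Qed.

Lemma walkcSr a d p q k N :
  walkc a d p q.+1 k N.+1 = d * walkc a d p q.+1 k N + walkc a d p q k N.+1.
Proof. by rewrite walkcC walkcSl !(walkcC d). Qed.

Lemma walkc00S a d N : walkc a d 0 0 0 N.+1 = 0.
Proof.
rewrite /walkc /stayc big1 // => -[[|m] lt_m] _ /=.
  by rewrite !subn0 negbin0S !mul0r.
by rewrite negbin0S mulr0 !mul0r.
Qed.

(** [x] and [y] are the weighted counts of the walks from the first state that
    end there, respectively in the second state; the recurrences split a walk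
    according to its last step.  The sums may stop at any [K]
    beyond the largest possible number of returns from the second state; keeping [K] free lets the
    induction go through, because the step for [x] passes from [K] to [K - 1]
    in the sum for [y]. *)
Lemma row_closed_form (a b c d : R) (x y : nat -> R) :
    x 0%N = 1 -> y 0%N = 0 ->
    (forall n, x n.+1 = a * x n + c * y n) ->
    (forall n, y n.+1 = b * x n + d * y n) ->
  forall n,
    (forall K, (n < 2 * K)%N ->
       x n = \sum_(s < K) walkc a d s.+1 s (2 * s) n * (b * c) ^+ s) /\
    (forall K, (n <= 2 * K)%N ->
       y n = b * \sum_(s < K) walkc a d s.+1 s.+1 (2 * s).+1 n * (b * c) ^+ s).
Proof.
move=> x0 y0 xS yS; elim=> [|n [IHx IHy]]; split=> [[//|K]|K] leK.
- rewrite x0 big_ord_recl big1 => [|s _].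
    by rewrite /walkc /= stayc0 mul1r addr0.
  by rewrite /walkc lift0 mulnS mul0r.
- rewrite y0 big1 ?mulr0 // => s _; by rewrite /walkc mul0r.
- rewrite xS (IHx K.+1) ?(IHy K); [|lia..].
  under [in RHS]eq_bigr => s _ do rewrite walkcSl mulrDl -mulrA.
  rewrite big_split -big_distrr /=; congr (_ + _).
  (* A walk that ends with a crossing has made at least two: the term [s = 0]
     vanishes, and the others are shifted by one return. *)
  rewrite big_ord_recl walkc00S mul0r add0r !big_distrr; apply: eq_bigr => s _.
  rewrite lift0 (_ : 2 * s.+1 = (2 * s).+2)%N ?walkcSS ?exprS /=; [ring | lia].
- rewrite yS (IHx K) ?(IHy K); [|lia..].
  rewrite !big_distrr -big_split; apply: eq_bigr => s _ /=.
  rewrite walkcSr walkcSS; ring.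
Qed.

End StayCoefficients.

Lemma expmx2S (R : comNzRingType) (A : 'M[R]_2) n i j :
  (A ^+ n.+1) i j = A 0 j * (A ^+ n) i 0 + A 1 j * (A ^+ n) i 1.
Proof.
rewrite exprSr mxE big_ord_recl big_ord1 (_ : lift _ _ = 1); last exact/val_inj.
by rewrite ![A _ j * _]mulrC.
Qed.

Theorem theorem2p1 (R : realType) (A : 'M[R[i]]_2) (n : nat) (hn : (1 <= n)%N) :
  let a := A 0 0 in let b := A 0 1 in
  let c := A 1 0 in let d := A 1 1 in
  [/\ (A ^+ n) 0 0 = a ^+ n +
        \sum_(1 <= s < (n %/ 2).+1) \sum_(0 <= m < (n - 2 * s).+1)
          'C(n - s - m, s)%:R * 'C(m + s - 1, m)%:R
            * a ^+ (n - 2 * s - m) * b ^+ s * c ^+ s * d ^+ m,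
      (A ^+ n) 0 1 =
        \sum_(0 <= s < ((n - 1) %/ 2).+1) \sum_(0 <= m < (n - 2 * s - 1).+1)
          'C(n - s - m - 1, s)%:R * 'C(m + s, m)%:R
            * a ^+ (n - 2 * s - m - 1) * b ^+ (s + 1) * c ^+ s * d ^+ m,
      (A ^+ n) 1 0 =
        \sum_(0 <= s < ((n - 1) %/ 2).+1) \sum_(0 <= m < (n - 2 * s - 1).+1)
          'C(n - s - m - 1, s)%:R * 'C(m + s, m)%:R
            * a ^+ (n - 2 * s - m - 1) * b ^+ s * c ^+ (s + 1) * d ^+ m
    & (A ^+ n) 1 1 = d ^+ n +
        \sum_(1 <= s < (n %/ 2).+1) \sum_(0 <= m < (n - 2 * s).+1)
          'C(n - s - m - 1, s - 1)%:R * 'C(m + s, m)%:R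
            * a ^+ (n - 2 * s - m) * b ^+ s * c ^+ s * d ^+ m].
Proof.
move=> a b c d.
have [row0a row0b] := @row_closed_form _ a b c d
  (fun k => (A ^+ k) 0 0) (fun k => (A ^+ k) 0 1)
  ltac:(by rewrite /= expr0 mxE) ltac:(by rewrite /= expr0 mxE)
  (fun k => expmx2S _ A k 0 0) (fun k => expmx2S _ A k 0 1) n.
(* The second row is the first one read from the other state: [a] and [d], and
   [b] and [c], are exchanged. *)
have [row1d row1c] := @row_closed_form _ d c b a
  (fun k => (A ^+ k) 1 1) (fun k => (A ^+ k) 1 0)
  ltac:(by rewrite /= expr0 mxE) ltac:(by rewrite /= expr0 mxE)
  (fun k => etrans (expmx2S _ A k 1 1) (addrC _ _))
  (fun k => etrans (expmx2S _ A k 1 0) (addrC _ _)) n.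
(* The term [s = 0] of the diagonal sums is the walk that never crosses, which
   accounts for [a ^+ n] and [d ^+ n]. *)
split.
- rewrite (row0a (n %/ 2).+1); last lia.
  rewrite big_ord_recl mulr1 /walkc subn0 stayc10 big_add1 big_mkord.
  congr (_ + _); apply: eq_bigr => -[s lt_s] _; rewrite lift0 /=.
  rewrite ifT; last lia.
  rewrite big_distrl big_mkord; apply: eq_bigr => -[m lt_m] _ /=.
  rewrite negbinS /negbin exprMn.
  rewrite (_ : n - 2 * s.+1 - m + s.+1 = n - s.+1 - m)%N; last lia.
  rewrite (_ : (m + s.+1).-1 = m + s.+1 - 1)%N; [ring | lia].
- rewrite (row0b ((n - 1) %/ 2).+1); last lia.
  rewrite big_distrr big_mkord; apply: eq_bigr => -[s lt_s] _ /=.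
  rewrite /walkc ifT; last lia.
  rewrite big_distrl big_distrr big_mkord subnS -subn1.
  apply: eq_bigr => -[m lt_m] _ /=.
  rewrite negbinS /negbin addnS /= exprMn addn1 exprS.
  rewrite (_ : n - 2 * s - 1 - m + s = n - s - m - 1)%N; last lia.
  rewrite (_ : n - 2 * s - 1 - m = n - 2 * s - m - 1)%N; [ring | lia].
- rewrite (row1c ((n - 1) %/ 2).+1); last lia.
  rewrite big_distrr big_mkord; apply: eq_bigr => -[s lt_s] _ /=.
  rewrite walkcC /walkc ifT; last lia.
  rewrite big_distrl big_distrr big_mkord subnS -subn1.
  apply: eq_bigr => -[m lt_m] _ /=.
  rewrite negbinS /negbin addnS /= exprMn addn1 exprS.
  rewrite (_ : n - 2 * s - 1 - m + s = n - s - m - 1)%N; last lia.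
  rewrite (_ : n - 2 * s - 1 - m = n - 2 * s - m - 1)%N; [ring | lia].
- rewrite (row1d (n %/ 2).+1); last lia.
  rewrite big_ord_recl mulr1 /walkc subn0 stayc10 big_add1 big_mkord.
  congr (_ + _); apply: eq_bigr => -[s lt_s] _; rewrite lift0 /=.
  rewrite ifT; last lia.
  rewrite staycC big_distrl big_mkord; apply: eq_bigr => -[m lt_m] _ /=.
  rewrite negbinS [negbin _ m]/negbin exprMn addnS /=.
  rewrite (_ : n - 2 * s.+1 - m + s = n - s.+1 - m - 1)%N; last lia.
  rewrite !subn1 /=; ring.
Qed.
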